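(* Let $D$ be a database and $\Omega$ a partition of $D$ into $|\Omega|$ pairwise disjoint sub-databases, and let $\mathcal F=\{A_1,\ldots,A_Q\}$ be a set of $Q$ queries, each a subset of $\Omega$. Fix $\varepsilon>0$. The benchmark algorithm answers each query $A\in\mathcal F$ independently by $\hat N_1(A)=N(A)+\zeta_A$ with $\zeta_A\sim\mathrm{Lap}(1/\varepsilon)$, consuming total privacy budget $Q\varepsilon$. The sigma-counting algorithm uses $\varepsilon'=\varepsilon Q/|\Omega|$ (so that its total privacy budget $|\Omega|\varepsilon'$ equals $Q\varepsilon$): independently for each $\omega\in\Omega$ it sets $\hat N_2(\omega)=\max(N(\omega)+\zeta_\omega,0)$ with $\zeta_\omega\sim\mathrm{Lap}(1/\varepsilon')$, and answers $A\in\mathcal F$ by $\hat N_2(A)=\sum_{\omega\in A}\hat N_2(\omega)$. If $Q>|\Omega|^{3/2}$, then the utility of the sigma-counting algorithm on $\mathcal F$ is strictly larger than that of the benchmark algorithm on $\mathcal F$.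
   Context: $N(A)$ denotes the true number of rows in the sub-database $\bigcup_{\omega\in A}\omega$. $\mathrm{Lap}(\lambda)$ is the Laplace distribution with density $(2\lambda)^{-1}e^{-|x|/\lambda}$. The privacy budget of an algorithm is its total differential-privacy parameter computed by sequential composition (a Laplace mechanism with noise $\mathrm{Lap}(1/\varepsilon)$ on a count has parameter $\varepsilon$, and parameters add over mechanisms). The utility of an algorithm producing responses $\hat N(A)$ on a finite set of queries $\mathcal F$ is $\mathcal U=\frac{1}{\mathrm{card}(\mathcal F)}\sum_{A\in\mathcal F}\frac{2}{\mathrm{Var}(\hat N(A)\mid N(A))}$. *)

(* Defs.v *)
From HB Require Import structures.
From mathcomp Require Import all_boot all_order all_algebra.
From mathcomp Require Import all_classical all_reals all_analysis.
Set Implicit Arguments. Unset Strict Implicit. Unset Printing Implicit Defensive.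
Import Order.TTheory GRing.Theory Num.Def Num.Theory.
Local Open Scope classical_set_scope.
Local Open Scope ring_scope.

Section defs.
Context {R : realType} {d : measure_display} {T : measurableType d}.

Definition laplace_rv (P : probability T R) (X : T -> R) (lam : R) : Prop :=
  measurable_fun setT X /\
  forall B : set R, measurable B ->
    P (X @^-1` B) =
    (\int[lebesgue_measure]_(x in B) ((2 * lam)^-1 * expR (- `|x| / lam))%:E)%E.

Definition mutually_independent {I : finType} (P : probability T R)
    (S : {set I}) (X : I -> T -> R) : Prop :=
  forall B : I -> set R, (forall i, measurable (B i)) ->
    P (\bigcap_(i in [set i | i \in S]) (X i @^-1` B i)) =
    (\prod_(i in S) P (X i @^-1` B i))%E.

Definition utility {Om : finType} (P : probability T R) (F : {set {set Om}})
    (Nhat : {set Om} -> T -> R) : R :=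
  (#|F|%:R)^-1 * \sum_(A in F) (2 / fine ('V_P[Nhat A])).
End defs.

(* true count N(A) of the sub-database union over A, from counts n(omega) *)
Definition N {Om : finType} (n : Om -> nat) (A : {set Om}) : nat :=
  (\sum_(w in A) n w)%N.

Definition bench_resp {R : realType} {T : Type} {Om : finType} (n : Om -> nat)
    (Z1 : {set Om} -> T -> R) (A : {set Om}) : T -> R :=
  fun t => (N n A)%:R + Z1 A t.

Definition sigma_resp {R : realType} {T : Type} {Om : finType} (n : Om -> nat)
    (Z2 : Om -> T -> R) (A : {set Om}) : T -> R :=
  fun t => \sum_(w in A) Num.max ((n w)%:R + Z2 w t) 0.

(* Main.v *)
(* Both utilities are averages over [F], compared query by query.  The benchmark
   answer has variance [2 / eps ^+ 2].  Clipping at 0 is 1-Lipschitz and fixes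
   the true count, so each clipped noisy count has variance at most
   [2 / eps' ^+ 2]; by independence the sigma-counting answer has variance at
   most [2 * #|Om| / eps' ^+ 2 = 2 * #|Om| ^+ 3 / (eps * #|F|) ^+ 2], which is
   below [2 / eps ^+ 2] exactly when [#|Om| ^+ 3 < #|F| ^+ 2].  Since
   [2 / 0 = 0] here, that variance must also be shown positive: the answer
   dominates a Laplace variable, hence is unbounded above. *)
Require Import Defs.
From HB Require Import structures.
From mathcomp Require Import all_boot all_order all_algebra.
From mathcomp Require Import all_classical all_reals all_analysis.
From mathcomp Require Import measurable_realfun ring lra.
Set Implicit Arguments.
Unset Strict Implicit.
Unset Printing Implicit Defensive.
Import Order.TTheory GRing.Theory Num.Def Num.Theory.
Import numFieldNormedType.Exports.
Local Open Scope classical_set_scope.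
Local Open Scope ring_scope.

(** * The Laplace density and integration against a density *)

Definition laplace_pdf {R : realType} (lam x : R) : R :=
  (2 * lam)^-1 * expR (- `|x| / lam).

Lemma laplace_pdf_ge0 (R : realType) (lam x : R) : 0 < lam ->
  0 <= laplace_pdf lam x.
Proof. by move=> l0; rewrite mulr_ge0 ?expR_ge0// invr_ge0 mulr_ge0// ltW. Qed.

Lemma continuous_laplace_pdf (R : realType) (lam : R) :
  continuous (laplace_pdf lam).
Proof.
move=> x; apply: cvgM; first exact: cvg_cst.
apply: (@continuous_comp _ _ _ (fun x : R => - `|x| / lam) expR); last first.
  exact: continuous_expR.
apply: cvgM; last exact: cvg_cst.
by apply: cvgN; apply: cvg_norm.
Qed.

Lemma laplace_pdfN (R : realType) (lam x : R) :
  laplace_pdf lam (- x) = laplace_pdf lam x.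
Proof. by rewrite /laplace_pdf normrN. Qed.

(** The law of [X] is absolutely continuous with respect to [mu], and [g] agrees almost everywhere
    with its Radon-Nikodym derivative because both have the same integral over every measurable set.
    Change of variables then gives the formula. *)
Lemma ge0_integral_law_density (d d' : measure_display)
    (T : measurableType d) (T' : measurableType d') (R : realType)
    (P : probability T R) (mu : {sigma_finite_measure set T' -> \bar R})
    (X : T -> T') (g f : T' -> R) :
  measurable_fun setT X -> measurable_fun setT g -> measurable_fun setT f ->
  (forall x, 0 <= f x) ->
  (forall B : set T', measurable B ->
    P (X @^-1` B) = (\int[mu]_(x in B) (g x)%:E)%E) ->
  (\int[P]_t (f (X t))%:E = \int[mu]_x (f x * g x)%:E)%E.
Proof.
move=> mX mg mf f0 PX.
pose X' : {mfun T >-> T'} := mfun_Sub (mem_set mX).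
pose nu := distribution P X'.
have nuE B : measurable B -> nu B = (\int[mu]_(x in B) (g x)%:E)%E.
  exact: PX.
have mEg : measurable_fun setT (EFin \o g) by exact/measurable_EFinP.
have mEf : measurable_fun setT (EFin \o f) by exact/measurable_EFinP.
have numu : nu `<< mu.
  apply/null_content_dominatesP => B mB B0; rewrite nuE//.
  by apply: null_set_integral => //; exact: measurable_funTS.
have -> : (\int[P]_t (f (X t))%:E = \int[nu]_x (f x)%:E)%E.
  by rewrite (ge0_integral_distribution X' mEf)// => y; rewrite lee_fin.
have fD := Radon_Nikodym_SigmaFinite.f_integrable numu.
rewrite -(Radon_Nikodym_SigmaFinite.change_of_variables numu)//.
apply: ae_eq_integral => //.
- by apply: emeasurable_funM => //; exact: measurable_int fD.
- by apply/measurable_EFinP; exact: measurable_funM.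
under [X in ae_eq _ _ _ X]eq_fun do rewrite EFinM.
apply: ae_eqe_mul2l; apply: integral_ae_eq => // E _ mE.
by rewrite -Radon_Nikodym_SigmaFinite.f_integral//; exact: nuE.
Qed.

Lemma laplace_integral (d : measure_display) (T : measurableType d)
    (R : realType) (P : probability T R) (X : T -> R) (lam : R) (f : R -> R) :
  laplace_rv P X lam -> measurable_fun setT f -> (forall x, 0 <= f x) ->
  (\int[P]_t (f (X t))%:E =
   \int[lebesgue_measure]_x (f x * laplace_pdf lam x)%:E)%E.
Proof.
move=> [mX PX] mf f0.
have mg : measurable_fun setT (laplace_pdf lam).
  apply: continuous_measurable_fun; exact: continuous_laplace_pdf.
exact: (@ge0_integral_law_density _ _ T (measurableTypeR R)).
Qed.

(** Bridges the real-exponent power of [|X|] in the norm behind [Lfun] and the ordinary square, in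
    which all moments below are computed. *)
Lemma Lfun2P (d : measure_display) (T : measurableType d) (R : realType)
    (P : probability T R) (X : T -> R) :
  measurable_fun setT X -> (\int[P]_t (X t ^+ 2)%:E < +oo)%E ->
  X \in Lfun P 2%:E.
Proof.
move=> mX X2; rewrite inE; apply/andP; split; rewrite inE//=.
rewrite /finite_norm unlock.
apply: poweR_lty; apply: le_lt_trans X2.
apply: ge0_le_integral => //=.
- apply/measurable_EFinP.
  apply/(@measurableT_comp _ _ _ _ _ _ (fun x : R => x `^ 2)%R) => //.
  exact/measurableT_comp.
- by apply/measurable_EFinP; exact: measurable_funX.
- by move=> t _; rewrite powR_mulrn// real_normK// num_real.
Qed.

(** * The second moment of the Laplace density *)

Lemma is_derive_sqr_expRN_primitive (R : realType) (lam x : R) : 0 < lam ->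
  is_derive x 1
    (fun x => - (lam ^+ 2 * (2^-1 * (x / lam) ^+ 2 + x / lam + 1) *
                 expR (- x / lam)))
    (x ^+ 2 * ((2 * lam)^-1 * expR (- x / lam))).
Proof.
move=> l0; apply: is_derive_eq.
rewrite /GRing.scale/=.
field.
by rewrite gt_eqF.
Qed.

Lemma cvg_sqr_expRN (R : realType) :
  (2^-1 * u ^+ 2 + u + 1) * expR (- u) @[u --> +oo] --> (0 : R).
Proof.
(* For [u >= 1] the quadratic factor is at most [5/2 * u ^+ 2], and [expR u >= u ^+ 3 / 6]; hence
   the constant [15 = 6 * 5/2]. *)
apply: (@squeeze_cvgr _ _ _ _ (cst 0) (fun u => 15 * u^-1)).
- near=> u.
  have u1 : 1 <= u by near: u; exact: nbhs_pinfty_ge.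
  have u0 : 0 < u by exact: lt_le_trans u1.
  have := expR_ge1Dxn 2 (ltW u0); rewrite (_ : 3`!%:R = 6 :> R)// => e3.
  rewrite mulr_ge0 ?expR_ge0//=; last by nra.
  rewrite expRN ler_pdivrMr ?expR_gt0// mulrAC ler_pdivlMr//.
  nra.
- exact: cvg_cst.
- rewrite -(mulr0 15); apply: cvgM; first exact: cvg_cst.
  by apply/gtr0_cvgV0; [exact: nbhs_pinfty_gt|exact: cvg_id].
Unshelve. all: by end_near. Qed.

Lemma integral0y_sqr_laplace_pdf (R : realType) (lam : R) : 0 < lam ->
  (\int[lebesgue_measure]_(x in `[0%R, +oo[) (x ^+ 2 * laplace_pdf lam x)%:E
   = (lam ^+ 2)%:E)%E.
Proof.
move=> l0.
(* Two integrations by parts produce this primitive, valid where [|x| = x]. It equals [- lam ^+ 2]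
   at 0 and tends to 0 at infinity. *)
pose F x := - (lam ^+ 2 * (2^-1 * (x / lam) ^+ 2 + x / lam + 1) *
                 expR (- x / lam)).
have cF x : F y @[y --> x] --> F x.
  apply: differentiable_continuous; apply/derivable1_diffP.
  by have [] := is_derive_sqr_expRN_primitive x l0.
rewrite (@ge0_continuous_FTC2y _ _ F _ 0)//.
- rewrite /F !(mul0r, oppr0) expR0 expr0n/= mulr0 !add0r !mulr1.
  by rewrite opprK.
- by move=> x _; rewrite mulr_ge0 ?sqr_ge0 ?laplace_pdf_ge0.
- apply: continuous_subspaceT => x.
  by apply: cvgM; [exact: exprn_continuous|exact: continuous_laplace_pdf].
- rewrite -oppr0 -(mulr0 (lam ^+ 2)); apply: cvgN.
  under eq_fun do rewrite -mulrA mulNr.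
  apply: cvgM; first exact: cvg_cst.
  apply: (@cvg_comp _ _ _ (fun x => x / lam)
    (fun u => (2^-1 * u ^+ 2 + u + 1) * expR (- u)) _ (pinfty_nbhs R)).
    by apply: gt0_cvgMly; rewrite ?invr_gt0//; exact: cvg_id.
  exact: cvg_sqr_expRN.
- exact: cvg_at_right_filter.
- move=> x; rewrite in_itv/= andbT => x0.
  rewrite derive1E.
  have [_ ->] := is_derive_sqr_expRN_primitive x l0.
  by rewrite /laplace_pdf gtr0_norm.
Qed.

Lemma integral_sqr_laplace_pdf (R : realType) (lam : R) : 0 < lam ->
  (\int[lebesgue_measure]_x (x ^+ 2 * laplace_pdf lam x)%:E
   = (2 * lam ^+ 2)%:E)%E.
Proof.
move=> l0; rewrite ge0_symfun_integralT.
- by rewrite -set_itvcy integral0y_sqr_laplace_pdf.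
- by move=> x; rewrite mulr_ge0 ?sqr_ge0 ?laplace_pdf_ge0.
- move=> x.
  by apply: cvgM; [exact: exprn_continuous|exact: continuous_laplace_pdf].
- by move=> x/=; rewrite sqrrN laplace_pdfN.
Qed.

(** Lebesgue measure is its own pushforward under negation. *)
Lemma ge0_integralTN (R : realType) (f : R -> \bar R) :
  measurable_fun setT f -> (forall x, (0 <= f x)%E) ->
  (\int[lebesgue_measure]_x f (- x)%R = \int[lebesgue_measure]_x f x)%E.
Proof.
move=> mf f0.
pose opp : R -> measurableTypeR R := -%R.
have mopp : measurable_fun setT opp.
  by apply: continuous_measurable_fun; exact: opp_continuous.
transitivity (\int[pushforward lebesgue_measure opp]_x f x)%E.
  by rewrite ge0_integral_pushforward// preimage_setT.
by apply: eq_measure_integral => A mA _; exact: lebesgue_measureN.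
Qed.

(** * Mean and variance of a Laplace variable *)

Section laplace_moments.
Context {R : realType} (d : measure_display) (T : measurableType d).
Context (P : probability T R) (X : T -> R) (lam : R).
Hypotheses (lam_gt0 : 0 < lam) (XP : laplace_rv P X lam).

Lemma laplace_second_moment : ('E_P[X ^+ 2])%E = (2 * lam ^+ 2)%:E.
Proof.
rewrite unlock -integral_sqr_laplace_pdf//.
rewrite -(laplace_integral (f := fun x => x ^+ 2) XP)//.
by move=> x; exact: sqr_ge0.
Qed.

Lemma laplace_Lfun2 : X \in Lfun P 2%:E.
Proof.
apply: Lfun2P; first by case: XP.
by have := laplace_second_moment; rewrite unlock => ->; rewrite ltry.
Qed.

(** The density is even, so the positive and negative parts of [X] have the same integral; square
    integrability makes that integral finite, so the difference is 0. *)
Lemma laplace_mean : ('E_P[X] = 0)%E.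
Proof.
have X1 : P.-integrable setT (EFin \o X).
  apply/Lfun1_integrable/(Lfun_subset12 (fin_num_measure P _ measurableT)).
  exact: laplace_Lfun2.
have mp : measurable_fun setT (fun x : R => Num.max x 0).
  exact: measurable_maxr.
have mn : measurable_fun setT (fun x : R => Num.max (- x) 0).
  exact: measurable_maxr.
have posE : (\int[P]_t ((EFin \o X)^\+ t) =
    \int[lebesgue_measure]_x (Num.max x 0 * laplace_pdf lam x)%:E)%E.
  rewrite -(laplace_integral XP mp)//; last first.
    by move=> x; rewrite le_max lexx orbT.
  by apply: eq_integral => t _; rewrite funeposE/= EFin_max.
have negE : (\int[P]_t ((EFin \o X)^\- t) =
    \int[lebesgue_measure]_x (Num.max (- x) 0 * laplace_pdf lam x)%:E)%E.
  rewrite -(laplace_integral XP mn)//; last first.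
    by move=> x; rewrite le_max lexx orbT.
  by apply: eq_integral => t _; rewrite funenegE/= EFin_max.
have symE : (\int[lebesgue_measure]_x
      (Num.max (- x) 0 * laplace_pdf lam x)%:E =
    \int[lebesgue_measure]_x (Num.max x 0 * laplace_pdf lam x)%:E)%E.
  rewrite -[RHS]ge0_integralTN.
  - by apply: eq_integral => x _; rewrite laplace_pdfN.
  - apply/measurable_EFinP; apply: measurable_funM => //.
    by apply: continuous_measurable_fun; exact: continuous_laplace_pdf.
  - by move=> x; rewrite lee_fin mulr_ge0 ?laplace_pdf_ge0// le_max lexx orbT.
rewrite unlock integralE negE symE posE.
rewrite subee// -posE; apply: integrable_fin_num => //.
exact: integrable_funepos.
Qed.

Lemma laplace_variance : ('V_P[X])%E = (2 * lam ^+ 2)%:E.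
Proof.
rewrite varianceE ?laplace_Lfun2// laplace_mean laplace_second_moment.
by rewrite expe2 mule0 sube0.
Qed.

End laplace_moments.

(** * Independence and the variance of a sum *)

Section uncorrelated.
Context {R : realType} (d : measure_display) (T : measurableType d).
Context (P : probability T R).

(* The joint law of [X] and [Y] is the product of their laws, so Tonelli
   applies. *)
Lemma ge0_expectationM (X Y : T -> R) :
  measurable_fun setT X -> measurable_fun setT Y ->
  (forall t, 0 <= X t) -> (forall t, 0 <= Y t) ->
  (forall A B : set R, measurable A -> measurable B ->
    P (X @^-1` A `&` Y @^-1` B) = (P (X @^-1` A) * P (Y @^-1` B))%E) ->
  ('E_P[X * Y] = 'E_P[X] * 'E_P[Y])%E.
Proof.
move=> mX mY X0 Y0 indep.
pose X' : {mfun T >-> R} := mfun_Sub (mem_set mX).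
pose Y' : {mfun T >-> R} := mfun_Sub (mem_set mY).
have mXY : measurable_fun setT (fun t => (X t, Y t)).
  exact: measurable_fun_pair.
pose XY : {mfun T >-> (R * R)%type} := mfun_Sub (mem_set mXY).
(* The absolute values make the integrand nonnegative on the whole plane, as Tonelli requires, and
   change nothing on the values of [X] and [Y]. *)
pose f (z : (R * R)%type) := (`|z.1| * `|z.2|)%:E.
have mf : measurable_fun setT f.
  apply/measurable_EFinP; apply: measurable_funM; exact: measurableT_comp.
have f0 z : (0 <= f z)%E by rewrite lee_fin mulr_ge0.
have mabs : measurable_fun setT (fun x : R => `|x|%:E).
  exact/measurable_EFinP.
have -> : ('E_P[X * Y] = \int[distribution P XY]_z f z)%E.
  rewrite unlock ge0_integral_distribution//.
  by apply: eq_integral => t _; rewrite /f/= !ger0_norm.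
have -> : ('E_P[X] = \int[distribution P X']_x `|x|%:E)%E.
  rewrite unlock ge0_integral_distribution//.
  by apply: eq_integral => t _; rewrite /= ger0_norm.
have -> : ('E_P[Y] = \int[distribution P Y']_x `|x|%:E)%E.
  rewrite unlock ge0_integral_distribution//.
  by apply: eq_integral => t _; rewrite /= ger0_norm.
transitivity (\int[distribution P X' \x distribution P Y']_z f z)%E.
  apply: eq_measure_integral => A mA _; apply/esym.
  (* A measure is the product measure once it agrees with it on measurable rectangles, which is what
     [indep] says. *)
  by apply: product_measure_unique => // B C mB mC; exact: indep.
rewrite fubini_tonelli1// /fubini_F -ge0_integralZr//; last first.
  by apply: integral_ge0.
apply: eq_integral => x _; rewrite /f/=.
by under eq_integral do rewrite EFinM; rewrite ge0_integralZl.
Qed.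

(** Bienaymé's identity: splitting off one term leaves twice its covariance with the remaining sum,
    which vanishes by bilinearity. *)
Lemma variance_sum (I : eqType) (s : seq I) (Y : I -> T -> R) : uniq s ->
  (forall i, i \in s -> Y i \in Lfun P 2%:E) ->
  {in s &, forall i j, i != j -> covariance P (Y i) (Y j) = 0%E} ->
  ('V_P[(\sum_(i <- s) Y i)%R] = \sum_(i <- s) 'V_P[Y i])%E.
Proof.
elim: s => [|i s IH] /=; first by rewrite !big_nil variance_cst.
move=> /andP[iNs us] Y2 cov0; rewrite !big_cons.
have Ys2 j : j \in s -> Y j \in Lfun P 2%:E.
  by move=> js; apply: Y2; rewrite inE js orbT.
have Yi2 : Y i \in Lfun P 2%:E by apply: Y2; rewrite mem_head.
have sum2 (r : seq I) : {subset r <= s} ->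
    \sum_(j <- r) Y j \in Lfun P 2%:E.
  move=> rs; rewrite big_seq.
  by apply: rpred_sum => [|? j /rs/Ys2//]; rewrite lee1n.
rewrite (varianceD Yi2 (sum2 s (fun _ => id))).
rewrite IH//; last first.
  by move=> j k js ks; apply: cov0; rewrite inE ?js ?ks orbT.
suff -> : covariance P (Y i) (\sum_(j <- s) Y j) = 0%E by rewrite mule0 adde0.
(* The inner induction runs over lists [r] contained in the fixed [s], so that the hypotheses on
   members of [s] stay available. *)
have : {subset s <= s} by [].
elim: {1 3}s => [|j r IHr] rs; first by rewrite big_nil covariance_cst_r.
have rs' : {subset r <= s} by move=> k kr; apply: rs; rewrite inE kr orbT.
have js : j \in s by apply: rs; rewrite mem_head.
rewrite big_cons (covarianceDr Yi2 (Ys2 _ js) (sum2 _ rs')).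
rewrite IHr// adde0 cov0//.
- by rewrite mem_head.
- by rewrite inE js orbT.
- by apply: contraNneq iNs => ->.
Qed.

End uncorrelated.

Lemma mutually_independent_pair {R : realType} (d : measure_display)
    (T : measurableType d) (P : probability T R) (I : finType) (S : {set I})
    (X : I -> T -> R) (i j : I) (A B : set R) :
  mutually_independent P S X -> i \in S -> j \in S -> i != j ->
  measurable A -> measurable B ->
  P (X i @^-1` A `&` X j @^-1` B) = (P (X i @^-1` A) * P (X j @^-1` B))%E.
Proof.
move=> indep iS jS ij mA mB.
(* Every other coordinate is left unconstrained and contributes a factor 1 to the product. *)
pose C k := if k == i then A else if k == j then B else setT.
have mC k : measurable (C k) by rewrite /C; case: ifP => // _; case: ifP.
have Ci : C i = A by rewrite /C eqxx.
have Cj : C j = B by rewrite /C eq_sym (negbTE ij) eqxx.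
have := indep C mC.
rewrite (bigD1 i)//= (bigD1 j)/=; last by rewrite jS eq_sym.
rewrite Ci Cj big1 ?mule1 => [<-|k /andP[/andP[_ ki] kj]]; last first.
  by rewrite /C (negbTE ki) (negbTE kj) preimage_setT probability_setT.
congr (P _); apply/seteqP; split => [t [Ai Bj] k _|t CX].
  by rewrite /C/=; case: eqP => [->//|_]; case: eqP => [->//|].
by split; [move: (CX i iS); rewrite /= Ci|move: (CX j jS); rewrite /= Cj].
Qed.

(** * General variance bounds and the Laplace tail *)

Section variance_bounds.
Context {R : realType} (d : measure_display) (T : measurableType d).
Context (P : probability T R).

Lemma variance_le_second_moment (X : T -> R) : X \in Lfun P 2%:E ->
  ('V_P[X] <= 'E_P[X ^+ 2])%E.
Proof.
by move=> X2; rewrite varianceE//; apply: geeDl; rewrite oppe_le0 sqre_ge0.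
Qed.

(** By Chebyshev at distance 1, the variance is at least the probability of being 1 or more away
    from the mean, an event containing an upper tail. *)
Lemma variance_gt0 (X : T -> R) : X \in Lfun P 2%:E ->
  (forall c, (0 < P (X @^-1` `[c, +oo[))%E) -> (0 < 'V_P[X])%E.
Proof.
move=> X2 tail; have /andP[/[!inE]/= mX _] := X2.
pose X' : {mfun T >-> R} := mfun_Sub (mem_set mX).
have := chebyshev (P := P) X' ltr01; rewrite expr1n invr1 mul1e.
apply: lt_le_trans; apply: lt_le_trans (tail (fine 'E_P[X] + 1)) _.
have mE : measurable_fun setT (fun t => `|X t - fine 'E_P[X]|).
  by apply: measurableT_comp => //; exact: measurable_funB.
apply: le_measure; rewrite ?inE.
- by rewrite -[X in measurable X]setTI; exact: (mX).
- rewrite [X in measurable X](_ : _ =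
    setT `&` (fun t => `|X t - fine 'E_P[X]|) @^-1` `[1, +oo[).
    exact: mE.
  by rewrite setTI; apply/seteqP; split => t /=; rewrite in_itv/= andbT.
- move=> t /=; rewrite in_itv/= andbT => ge.
  by rewrite (le_trans _ (ler_norm _))// lerBrDl.
Qed.

(** The half-line from [c] contains a unit interval starting at [|c|]; there the density is
    decreasing, hence at least its positive value at the right end. *)
Lemma laplace_tail_gt0 (X : T -> R) (lam c : R) :
  0 < lam -> laplace_rv P X lam -> (0 < P (X @^-1` `[c, +oo[))%E.
Proof.
move=> l0 [mX ->]//.
pose a : R := `|c|.
have mpdf : measurable_fun setT (fun x => (laplace_pdf lam x)%:E).
  apply/measurable_EFinP; apply: continuous_measurable_fun.
  exact: continuous_laplace_pdf.
have pos : 0 < laplace_pdf lam (a + 1).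
  by rewrite mulr_gt0 ?expR_gt0// invr_gt0 mulr_gt0.
apply: (@lt_le_trans _ _ (\int[lebesgue_measure]_(x in `[a, (a + 1)%R])
    (laplace_pdf lam (a + 1))%:E)%E).
  rewrite integral_cst//= lebesgue_measure_itv/= lte_fin ltrDl ltr01.
  by rewrite -EFinB addrAC subrr add0r mule1 lte_fin.
apply: (@le_trans _ _ (\int[lebesgue_measure]_(x in `[a, (a + 1)%R])
    (laplace_pdf lam x)%:E)%E).
  apply: ge0_le_integral => //.
  - by move=> x _; rewrite lee_fin ltW.
  - exact: measurable_funTS.
  - move=> x; rewrite /= in_itv/= => /andP[ax xa].
    have x0 : 0 <= x by apply: le_trans ax; exact: normr_ge0.
    have a0 : 0 <= a + 1 by rewrite addr_ge0// normr_ge0.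
    rewrite lee_fin ler_wpM2l ?invr_ge0 ?mulr_ge0 ?(ltW l0)// ler_expR.
    by rewrite ler_pM2r ?invr_gt0// lerN2 !ger0_norm.
apply: ge0_subset_integral => //.
- exact: measurable_funTS.
- by move=> x _; rewrite lee_fin laplace_pdf_ge0.
- move=> x; rewrite /= !in_itv/= andbT => /andP[ax _].
  exact: le_trans (ler_norm _) ax.
Qed.

End variance_bounds.

(** * The clipped noisy count *)

Section clipped_laplace.
Context {R : realType} (d : measure_display) (T : measurableType d).
Context (P : probability T R) (Z : T -> R) (lam c : R).
Hypotheses (lam_gt0 : 0 < lam) (ZP : laplace_rv P Z lam) (c_ge0 : 0 <= c).

Local Notation Y := (fun t => Num.max (c + Z t) 0).
(** Centred at the true count [c] rather than at the mean of [Y]: the shift preserves the variance,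
    and the second moment of [W] bounds it. *)
Local Notation W := (Y \- cst c).

Let mZ : measurable_fun setT Z. Proof. by case: ZP. Qed.

Let mW : measurable_fun setT W.
Proof.
apply: measurable_funB => //; apply: measurable_maxr => //.
exact: measurable_funD.
Qed.

(* Clipping at 0 is 1-Lipschitz and fixes [c]. *)
Let clip_dist t : W t ^+ 2 <= Z t ^+ 2.
Proof.
(* Without clipping [W t = Z t]; with clipping [W t = - c], where [0 <= c <= - Z t]. *)
rewrite /=; case: (leP (c + Z t) 0) => h; last by rewrite addrAC subrr add0r.
have cZ : c <= - Z t by rewrite -[leRHS]sub0r lerBrDr.
by rewrite sub0r sqrrN -[leRHS]sqrrN ler_sqr ?nnegrE// (le_trans c_ge0).
Qed.

Let second_moment_W : ('E_P[W ^+ 2] <= (2 * lam ^+ 2)%:E)%E.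
Proof.
rewrite -(laplace_second_moment lam_gt0 ZP); apply: expectation_le.
- exact: measurable_funM mW mW.
- exact: measurable_funM mZ mZ.
- by move=> t; exact: sqr_ge0.
- by move=> t; exact: sqr_ge0.
- by apply/aeW => t; exact: clip_dist.
Qed.

Let W_Lfun2 : W \in Lfun P 2%:E.
Proof.
apply: Lfun2P => //; have := second_moment_W; rewrite unlock => /le_lt_trans.
by apply; rewrite ltry.
Qed.

Let YE : Y = W \+ cst c.
Proof. by apply/funext => t; rewrite /= subrK. Qed.

Lemma clipped_laplace_Lfun2 : Y \in Lfun P 2%:E.
Proof. by rewrite YE rpredD ?lee1n//= => _; rewrite Lfun_cst. Qed.

Lemma clipped_laplace_variance : ('V_P[Y] <= (2 * lam ^+ 2)%:E)%E.
Proof.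
rewrite YE varianceD_cst_r//; apply: le_trans second_moment_W.
exact: variance_le_second_moment.
Qed.

End clipped_laplace.

(** * Variances of the two kinds of answer *)

Lemma bench_resp_variance {R : realType} (d : measure_display)
    (T : measurableType d) (P : probability T R) (Om : finType) (n : Om -> nat)
    (Z : {set Om} -> T -> R) (A : {set Om}) (lam : R) :
  0 < lam -> laplace_rv P (Z A) lam ->
  ('V_P[bench_resp n Z A])%E = (2 * lam ^+ 2)%:E.
Proof.
move=> l0 ZP; rewrite -(laplace_variance l0 ZP).
exact: varianceD_cst_l (laplace_Lfun2 l0 ZP).
Qed.

Section sigma_resp_variance.
Context {R : realType} (d : measure_display) (T : measurableType d).
Context (P : probability T R) (Om : finType) (n : Om -> nat).
Context (Z : Om -> T -> R) (A : {set Om}) (lam : R).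
Hypotheses (lam_gt0 : 0 < lam) (ZP : forall w, laplace_rv P (Z w) lam).
Hypothesis Zind : mutually_independent P [set: Om] Z.

Let Y w t : R := Num.max ((n w)%:R + Z w t) 0.

Let Y_Lfun2 w : Y w \in Lfun P 2%:E.
Proof. exact: clipped_laplace_Lfun2 lam_gt0 (ZP w) (ler0n _ _). Qed.

Let Y_ge0 w t : 0 <= Y w t. Proof. by rewrite le_max lexx orbT. Qed.

Let mY w : measurable_fun setT (Y w).
Proof. by have /andP[/[!inE]] := Y_Lfun2 w. Qed.

(** Each clipped count is a measurable function of its own noise, so independence passes from the
    noises to the counts, which are nonnegative as [ge0_expectationM] requires. *)
Let Y_uncorrelated w w' : w != w' -> covariance P (Y w) (Y w') = 0%E.
Proof.
move=> ww'.
have Y1 v : Y v \in Lfun P 1.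
  exact: (Lfun_subset12 (fin_num_measure P _ measurableT)).
rewrite covarianceE ?Lfun2_mul_Lfun1//.
have mg v : measurable_fun setT (fun z : R => Num.max ((n v)%:R + z) 0).
  by apply: measurable_maxr => //; exact: measurable_funD.
rewrite ge0_expectationM ?subee ?fin_numM ?expectation_fin_num//.
move=> B C mB mC.
have := mutually_independent_pair Zind (finset.in_setT w)
  (finset.in_setT w') ww'.
move=> /(_ ((fun z : R => Num.max ((n w)%:R + z) 0) @^-1` B)
           ((fun z : R => Num.max ((n w')%:R + z) 0) @^-1` C)).
by apply; rewrite -[X in measurable X]setTI; exact: mg.
Qed.

Let sigma_respE : sigma_resp n Z A = \sum_(w <- enum A) Y w.
Proof. by rewrite fct_sumE; apply/funext => t; rewrite big_enum. Qed.

Let sigma_resp_Lfun2 : sigma_resp n Z A \in Lfun P 2%:E.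
Proof.
by rewrite sigma_respE; apply: rpred_sum => [|? w _];
  [rewrite lee1n|exact: Y_Lfun2].
Qed.

(** Ensures that [fine] in [utility] returns the actual variance and not its default value at
    infinity. *)
Lemma sigma_resp_variance_fin_num : ('V_P[sigma_resp n Z A])%E \is a fin_num.
Proof. exact: variance_fin_num. Qed.

Lemma sigma_resp_variance_le :
  ('V_P[sigma_resp n Z A] <= (#|A|%:R * (2 * lam ^+ 2))%:E)%E.
Proof.
rewrite sigma_respE variance_sum ?enum_uniq//; last first.
  by move=> w w' _ _; exact: Y_uncorrelated.
apply: (@le_trans _ _ (\sum_(w <- enum A) (2 * lam ^+ 2)%:E)%E).
  by apply: lee_sum => w _; exact: clipped_laplace_variance.
by rewrite sumEFin big_enum/= sumr_const -[X in (X%:E <= _)%E]mulr_natl.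
Qed.

Lemma sigma_resp_variance_gt0 : (0 < #|A|)%N ->
  (0 < 'V_P[sigma_resp n Z A])%E.
Proof.
case/card_gt0P => w wA; apply: variance_gt0 => // c.
(* The answer is at least [Z w], since the other summands and the true count [n w] are nonnegative;
   its tail event thus contains that of [Z w]. *)
apply: lt_le_trans (laplace_tail_gt0 c lam_gt0 (ZP w)) _.
have /andP[/[!inE]/= mS _] := sigma_resp_Lfun2.
have mZ : measurable_fun setT (Z w) by case: (ZP w).
apply: le_measure; rewrite ?inE.
- by rewrite -[X in measurable X]setTI; exact: mZ.
- by rewrite -[X in measurable X]setTI; exact: mS.
move=> t /=; rewrite !in_itv/= !andbT => /le_trans; apply.
rewrite /sigma_resp (bigD1 w)//=.
rewrite -[leLHS]addr0 lerD ?sumr_ge0 ?le_max ?lerDr ?ler0n//.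
by move=> v _; exact: Y_ge0.
Qed.

End sigma_resp_variance.

Theorem theorem2 (R : realType) (Om : finType) (n : Om -> nat)
  (F : {set {set Om}}) (eps : R) (heps : 0 < eps)
  (hF : forall A, A \in F -> (0 < #|A|)%N)
  (hQ : (#|Om|%:R : R) `^ (3 / 2) < (#|F|%:R : R))
  (d : measure_display) (T : measurableType d) (P : probability T R)
  (Z1 : {set Om} -> T -> R) (Z2 : Om -> T -> R)
  (hZ1law : forall A, A \in F -> laplace_rv P (Z1 A) eps^-1)
  (hZ1ind : mutually_independent P F Z1)
  (hZ2law : forall w, laplace_rv P (Z2 w) (eps * #|F|%:R / #|Om|%:R)^-1)
  (hZ2ind : mutually_independent P [set: Om] Z2) :
  utility P F (bench_resp n Z1) < utility P F (sigma_resp n Z2).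
Proof.
have Q0 : 0 < #|F|%:R :> R by exact: le_lt_trans (powR_ge0 _ _) hQ.
have [A0 A0F] : exists A, A \in F by apply/card_gt0P; rewrite -(ltr0n R).
(* A nonempty query forces [Om] to be nonempty, so the division by [#|Om|] in the noise scale is
   genuine. *)
have m0 : 0 < #|Om|%:R :> R.
  by rewrite ltr0n; exact: leq_trans (hF _ A0F) (max_card _).
(* Squaring [hQ] trades the exponent [3 / 2] for integer powers. *)
have m3Q2 : #|Om|%:R ^+ 3 < #|F|%:R ^+ 2 :> R.
  have -> : #|Om|%:R ^+ 3 = ((#|Om|%:R : R) `^ (3 / 2)) ^+ 2.
    rewrite -[RHS]powR_mulrn ?powR_ge0// -powRrM divfK ?pnatr_eq0//.
    by rewrite powR_mulrn ?ler0n.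
  by rewrite ltr_sqr ?nnegrE ?powR_ge0 ?ler0n.
rewrite /utility ltr_pM2l ?invr_gt0//.
rewrite -!big_enum/=; rewrite big_seq [ltRHS]big_seq; apply: ltr_sum.
  (* Strictness of the summed inequality needs at least one query. *)
  by apply/hasP; exists A0; rewrite ?mem_enum.
move=> A; rewrite mem_enum => AF.
set lam := (_)^-1 in hZ2law.
have lam0 : 0 < lam by rewrite invr_gt0 divr_gt0// mulr_gt0.
have Vfin := sigma_resp_variance_fin_num n A lam0 hZ2law.
have := sigma_resp_variance_gt0 n lam0 hZ2law (hF _ AF).
have := sigma_resp_variance_le n A lam0 hZ2law hZ2ind.
rewrite (bench_resp_variance n _ (hZ1law _ AF)) ?invr_gt0//=.
rewrite -(fineK Vfin) lee_fin lte_fin; set V := fine _ => Vle V0.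
have Vm : V <= #|Om|%:R * (2 * lam ^+ 2).
  apply: le_trans Vle _; apply: ler_wpM2r; last by rewrite ler_nat max_card.
  by rewrite pmulr_rge0// sqr_ge0.
(* Inversion reverses the order only between positive variances; [V0] supplies this for [V]. *)
rewrite ltr_pM2l// ltf_pV2 ?posrE ?mulr_gt0 ?exprn_gt0 ?invr_gt0//.
apply: le_lt_trans Vm _; rewrite mulrCA ltr_pM2l//.
(* Here [lam = #|Om| / (eps * #|F|)]; the last factor is the variance ratio, below 1 by [m3Q2]. *)
have -> : #|Om|%:R * lam ^+ 2 = eps^-1 ^+ 2 * (#|Om|%:R ^+ 3 / #|F|%:R ^+ 2).
  rewrite /lam; field.
  by rewrite !gt_eqF.
by rewrite gtr_pMr ?exprn_gt0 ?invr_gt0// ltr_pdivrMr ?mul1r// exprn_gt0.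
Qed.
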